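(* If $A\in G(\Omega_n)$ is totally nonnegative as an element of $GL_n$ (i.e. $A$ is real with all minors $\ge 0$), then $A\in G(\Omega_n)^{\ge0}$, where $G(\Omega_n)^{\ge 0}$ is the totally nonnegative part of the reductive group $G(\Omega_n)$ in the sense of Lusztig, defined with respect to the diagonal torus and the Chevalley generators specified in the context.
   Context: $\Omega_n=\sum_{i=1}^n(-1)^{i+1}E_{i,n+1-i}$, where $E_{i,j}$ are matrix units, and $G(\Omega_n)=\{A\in GL_n(\mathbb C)\mid A\Omega_nA^t=\Omega_n\}$; this is a symplectic group for even $n$ and an orthogonal group for odd $n$. Let $k=\lfloor n/2\rfloor$ and let $T\subset G(\Omega_n)$ be the subgroup of diagonal matrices (with diagonal entries $x_1,\dots,x_k,x_k^{-1},\dots,x_1^{-1}$ for $n=2k$, and $x_1,\dots,x_k,\pm1,x_k^{-1},\dots,x_1^{-1}$ for $n=2k+1$). Chevalley generators: if $n=2k$, $E_i=E_{i,i+1}+E_{2k-i,2k-i+1}$ for $i<k$ and $E_k=E_{k,k+1}$; if $n=2k+1$, $E_i=E_{i,i+1}+E_{2k-i+1,2k-i+2}$ for $i<k$ and $E_k=\sqrt2\,(E_{k,k+1}+E_{k+1,k+2})$; in both cases $F_i=E_i^t$ for all $i\in\{1,\dots,k\}$. Put $X_i(t)=\exp(tE_i)$ and $X_{-i}(t)=\exp(tF_i)$. $\mathbb R_+$ denotes the positive reals and $T^{>0}=\{H\in T\mid\chi(H)\in\mathbb R_+\ \forall\chi\in\mathrm{Hom}(T,\mathbb C^* )\}$.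 The totally nonnegative part $G(\Omega_n)^{\ge0}$ is the submonoid of $G(\Omega_n)$ generated by $T^{>0}$ and the elements $X_i(t)$, $i\in\{-k,\dots,-1\}\cup\{1,\dots,k\}$, $t\in\mathbb R_+$. *)

(* Defs.v *)
From HB Require Import structures.
From mathcomp Require Import all_boot all_order all_algebra complex.
From mathcomp Require Import boolp classical_sets reals topology normedtype.
From mathcomp Require Import sequences.
From mathcomp Require mpoly.

Set Implicit Arguments.
Unset Strict Implicit.
Unset Printing Implicit Defensive.

Import Order.TTheory GRing.Theory Num.Theory numFieldNormedType.Exports.

Local Open Scope classical_set_scope.
Local Open Scope ring_scope.

(* The matrix exponential, as the limit of the partial sums of its series in
   the normed space of matrices. *)
Definition mxexp (K : numFieldType) (n : nat) (A : 'M[K]_n) : 'M[K]_n :=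
  lim (series (fun m : nat => (m`!%:R)^-1 *: A ^+ m) @ \oo).

(* Matrix units are indexed from 1; an index out of range gives 0. *)
Definition E_ (K : pzRingType) (n : nat) (i j : nat) : 'M[K]_n :=
  \matrix_(a < n, b < n) ((a.+1 == i) && (b.+1 == j))%:R.

Definition Omega (K : pzRingType) (n : nat) : 'M[K]_n :=
  \sum_(1 <= i < n.+1) (-1) ^+ i.+1 *: E_ K n i (n.+1 - i).

Definition GOmega (K : fieldType) (n : nat) : set 'M[K]_n :=
  [set A | A \in unitmx /\ A *m Omega K n *m A^T = Omega K n].

Definition TOmega (K : fieldType) (n : nat) : set 'M[K]_n :=
  [set H | GOmega H /\ is_diag_mx H].

Definition chevE (C : numClosedFieldType) (n i : nat) : 'M[C]_n :=
  let k := n./2 in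
  if odd n then
    if (i < k)%N
    then E_ C n i i.+1 + E_ C n (k.*2 - i).+1 (k.*2 - i).+2
    else sqrtC 2%:R *: (E_ C n k k.+1 + E_ C n k.+1 k.+2)
  else
    if (i < k)%N
    then E_ C n i i.+1 + E_ C n (k.*2 - i) (k.*2 - i).+1
    else E_ C n k k.+1.

Definition chevF (C : numClosedFieldType) (n i : nat) : 'M[C]_n :=
  (chevE C n i)^T.

(* X_i(t) for a nonzero integer i: a negative index stands for the
   generator F_{|i|}. *)
Definition chevX (C : numClosedFieldType) (n : nat) (i : int) (t : C) :
    'M[C]_n :=
  mxexp (t *: (if 0 < i then chevE C n `|i| else chevF C n `|i|)).

(* Regular functions on a closed subvariety Z of GL_n: restrictions of elements
   of K[x_11, ..., x_nn, 1/det]. *)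
Definition regular_on (K : fieldType) (n : nat) (Z : set 'M[K]_n)
    (f : 'M[K]_n -> K) : Prop :=
  exists (p : mpoly.mpoly (n * n) K) (m : nat), forall A, Z A ->
    f A = mpoly.meval (fun j => mxvec A 0 j) p / \det A ^+ m.

(* Hom(T, C^* ) consists of homomorphisms of algebraic groups; such a character
   is represented by a function on all matrices, of which only the values on T
   matter. *)
Definition character (K : fieldType) (n : nat) (T : set 'M[K]_n)
    (chi : 'M[K]_n -> K) : Prop :=
  [/\ regular_on T chi,
      forall H, T H -> chi H != 0 &
      forall H1 H2, T H1 -> T H2 -> chi (H1 *m H2) = chi H1 * chi H2].

(* In a numClosedFieldType, 0 < z and 0 <= z entail that z is real. *)
Definition Tpos (C : numClosedFieldType) (n : nat) : set 'M[C]_n :=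
  [set H | TOmega H /\ forall chi, character (@TOmega C n) chi -> 0 < chi H].

Definition submonoid (K : pzRingType) (n : nat) (M : set 'M[K]_n) : Prop :=
  M 1%:M /\ forall A B, M A -> M B -> M (A *m B).

Definition chev_gens (C : numClosedFieldType) (n : nat) : set 'M[C]_n :=
  [set A | exists (i : int) (t : C),
     [/\ (1 <= `|i| <= n./2)%N, 0 < t & A = chevX n i t]].

Definition GOmega_ge0 (C : numClosedFieldType) (n : nat) : set 'M[C]_n :=
  smallest (@submonoid C n) (@Tpos C n `|` @chev_gens C n).

Definition totally_nonneg (K : numDomainType) (n : nat) (A : 'M[K]_n) : Prop :=
  (forall i j, A i j \is Num.real) /\
  forall (r : nat) (f g : 'I_r -> 'I_n),
    {homo f : i j / (i < j)%N} -> {homo g : i j / (i < j)%N} ->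
    0 <= \det (mxsub f g A).

(* Main.v *)
(** Whitney reduction subtracts from a row of a totally nonnegative matrix the
    multiple of the row above that kills the lowest nonzero entry of the first
    column not yet reduced; total nonnegativity survives.  Writing tau for the
    involution of GL_n with fixed group G(Omega), such reductions show that tau
    preserves total nonnegativity, and that tau turns a reduction at rows
    (p, p+1) into one at the reflected rows.  For a tau-fixed A the reduction
    and its mirror image can be performed together, which splits off one factor
    X_{-i}(t); when n is odd and the middle row is involved, total nonnegativity
    of the tau-images forces the parameters t, 2t, t of the rank two
    factorization of X_{-k}.  Once A is upper triangular the same procedure for
    its transpose leaves a positive diagonal matrix, on which every character
    is positive because it is a Laurent monomial on one-parameter subgroups. *)
Require Import Defs.
From mathcomp Require Import all_boot all_order all_algebra complex.
From mathcomp Require Import boolp classical_sets reals topology normedtype.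
From mathcomp Require Import sequences perm zify ring.
From mathcomp Require mpoly.

Set Implicit Arguments.
Unset Strict Implicit.
Unset Printing Implicit Defensive.

Import Order.TTheory GRing.Theory Num.Theory numFieldNormedType.Exports.

Local Open Scope ring_scope.

(** * Minors of totally nonnegative matrices *)

Lemma tnn_det (K : numDomainType) (n : nat) (A : 'M[K]_n) r
    (f g : 'I_r -> 'I_n) :
  totally_nonneg A ->
  {homo f : i j / (i < j)%N} -> {homo g : i j / (i < j)%N} ->
  0 <= \det (mxsub f g A).
Proof. by case=> _ h; exact: h. Qed.

Lemma tnn_ge0 (K : numDomainType) (n : nat) (A : 'M[K]_n) i j :
  totally_nonneg A -> 0 <= A i j.
Proof.
move=> hA; pose cst (a : 'I_n) := fun _ : 'I_1 => a.
have hc a : {homo cst a : i j / (i < j)%N} by move=> x y; rewrite !ord1.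
by have := tnn_det hA (hc i) (hc j); rewrite det_mx11 mxE.
Qed.

Lemma tnn_minors (K : numDomainType) (n : nat) (A : 'M[K]_n) :
  (forall r (f g : 'I_r -> 'I_n),
    {homo f : i j / (i < j)%N} -> {homo g : i j / (i < j)%N} ->
    0 <= \det (mxsub f g A)) -> totally_nonneg A.
Proof.
move=> h; split=> // i j; apply: ger0_real.
have hc (a : 'I_n) : {homo (fun _ : 'I_1 => a) : i j / (i < j)%N}.
  by move=> x y; rewrite !ord1.
by have := h _ _ _ (hc i) (hc j); rewrite det_mx11 mxE.
Qed.

Lemma tnn_tr (K : numDomainType) (n : nat) (A : 'M[K]_n) :
  totally_nonneg A -> totally_nonneg A^T.
Proof.
move=> hA; apply: tnn_minors => r f g hf hg.
by rewrite -trmx_mxsub det_tr; exact: tnn_det.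
Qed.

Lemma homo_ord_inj (r n : nat) (f : 'I_r -> 'I_n) :
  {homo f : i j / (i < j)%N} -> injective f.
Proof.
move=> hf i j eqf; apply/val_inj/eqP; rewrite eqn_leq.
by apply/andP; split; rewrite leqNgt; apply/negP => /hf; rewrite eqf ltnn.
Qed.

Lemma homo_lift (n : nat) (h : 'I_n) :
  {homo lift h : i j / (i < j)%N}.
Proof. by move=> i j; rewrite /= /bump; lia. Qed.

Lemma det_zero_col (R : comPzRingType) (n : nat) (A : 'M[R]_n) j :
  (forall i, A i j = 0) -> \det A = 0.
Proof.
by move=> h; rewrite (expand_det_col _ j) big1 // => i _; rewrite h mul0r.
Qed.

(** * A Pluecker relation and Whitney's inequality between minors *)

Definition upd (T : Type) r (f : 'I_r -> T) (i : 'I_r) (x : T) : 'I_r -> T :=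
  fun j => if j == i then x else f j.

Lemma homo_upd n r (f : 'I_r -> 'I_n) (i : 'I_r) (p : 'I_n) :
  {homo f : i j / (i < j)%N} -> f i = p.+1 :> nat ->
  (forall j, f j != p) -> {homo upd f i p : i j / (i < j)%N}.
Proof.
move=> hf fi fp a b ab; rewrite /upd.
case: eqP => [ea|na]; case: eqP => [eb|nb].
- by move: ab; rewrite ea eb ltnn.
- by have := hf _ _ ab; rewrite ea; lia.
- have := hf _ _ ab; rewrite eb fi ltnS leq_eqVlt => /orP[|//].
  by move=> /eqP /val_inj e; have := fp a; rewrite e eqxx.
- exact: hf.
Qed.

(* The entries of N *m \adj P are the determinants of P with one row replaced
   by a row of N, so that both evaluations of \adj N *m N *m \adj P give a
   Pluecker relation between the maximal minors of three extra rows. *)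
Lemma pluecker3 (R : comPzRingType) (s n : nat) (A : 'M[R]_n)
    (f : 'I_s.+1 -> 'I_n) (g : 'I_s.+1 -> 'I_n) (k m j : 'I_s.+1) (p : 'I_n) :
  m = k.+1 :> nat ->
  let N := mxsub f g A in let P := mxsub (upd f m p) g A in
  \det N * \det (row' k (col' j P)) =
  \det (row' k (col' j N)) * \det P +
  \det (row' m (col' j N)) * \det (mxsub (upd f k p) g A).
Proof.
move=> mk N P.
have km : k != m by apply/eqP => e; move: mk; rewrite e; lia.
set Q := mxsub (upd f k p) g A.
have NP l : l != m -> (N *m \adj P) l k = (\det P) *+ (l == k).
  move=> lm; transitivity ((P *m \adj P) l k); last by rewrite mul_mx_adj mxE.
  rewrite !mxE.
  apply: eq_bigr => x _; congr (_ * _); rewrite !mxE /upd.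
  by rewrite (negbTE lm).
have NPm : (N *m \adj P) m k = - \det Q.
  (* Row [k] of [Q'] is row [m] of [N] and its other rows are those of [P], so expanding [\det Q']
     along row [k] gives the entry; swapping back to [Q] costs a sign. *)
  pose Q' := xrow k m Q.
  have -> : - \det Q = \det Q'.
    by rewrite /Q' /xrow row_permE detM det_perm odd_tperm km mulN1r.
  rewrite mxE (expand_det_row Q' k); apply: eq_bigr => x _.
  rewrite !mxE /upd tpermL.
  rewrite (_ : (m == k) = false); last by rewrite eq_sym (negbTE km).
  congr (_ * _); rewrite /cofactor; congr (_ * \det _).
  apply/matrixP => a b; rewrite !mxE /upd.
  case: (altP (lift k a =P m)) => [->|am]; first by rewrite tpermR eqxx.
  by rewrite tpermD // ?[lift k a == k]eq_sym ?(negbTE (neq_lift _ _)) // eq_sym.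
have : (\adj N *m (N *m \adj P)) j k = \det N * \adj P j k.
  by rewrite mulmxA mul_adj_mx mul_scalar_mx mxE.
rewrite mxE (bigD1 k) //= (bigD1 m) 1?eq_sym //= big1 => [|l /andP[lk lm]]; last first.
  by rewrite NP // (negbTE lk) mulr0.
rewrite NP // eqxx mulr1n NPm addr0 !mxE /cofactor mk.
set x := \det (row' k _); set y := \det (row' m _); set z := \det (row' k _).
rewrite addSn exprS => /(congr1 ( *%R ((-1) ^+ (k + j)))).
have sg : (-1) ^+ (k + j) * (-1) ^+ (k + j) = 1 :> R.
  by rewrite -exprD addnn -signr_odd odd_double.
move: sg; set e := (-1) ^+ _ => sg h.
transitivity (e * (\det N * (e * z))).
  transitivity (e * e * (\det N * z)); [by rewrite sg mul1r|by ring].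
rewrite -h; transitivity (e * e * (x * \det P + y * \det Q)); last by rewrite sg mul1r.
by ring.
Qed.

(** The position in which subtracting a multiple of row [p] from row [q] clears the entry [(q, c)]
    safely: column [c] is already clean below [q], and the rows from [p] on are clean left of
    [c]. *)
Definition pivot (K : numDomainType) (n : nat) (A : 'M[K]_n) (p q c : 'I_n) :=
  [/\ q = p.+1 :> nat, 0 < A p c, forall a : 'I_n, (q < a)%N -> A a c = 0
    & forall a b : 'I_n, (b < c)%N -> (p <= a)%N -> A a b = 0].

Definition fcons (T : Type) r (x : T) (f : 'I_r -> T) : 'I_r.+1 -> T :=
  fun i => oapp f x (unlift ord0 i).

Lemma fcons0 (T : Type) r (x : T) (f : 'I_r -> T) : fcons x f ord0 = x.
Proof. by rewrite /fcons unlift_none. Qed.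

Lemma fconsS (T : Type) r (x : T) (f : 'I_r -> T) i :
  fcons x f (lift ord0 i) = f i.
Proof. by rewrite /fcons liftK. Qed.

Lemma homo_fcons n r (x : 'I_n) (f : 'I_r -> 'I_n) :
  {homo f : i j / (i < j)%N} -> (forall i, x < f i)%N ->
  {homo fcons x f : i j / (i < j)%N}.
Proof.
move=> hf hx i j; case: (unliftP ord0 i) => [i'|] ->;
  case: (unliftP ord0 j) => [j'|] ->; rewrite ?fcons0 ?fconsS //.
by rewrite /= /bump /= ltnS; exact: hf.
Qed.

Lemma homo_ge_ord0 n r (f : 'I_r.+1 -> 'I_n) i :
  {homo f : i j / (i < j)%N} -> (f ord0 <= f i)%N.
Proof.
move=> hf; case: (unliftP ord0 i) => [i'|] -> //.
by apply/ltnW/hf.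
Qed.

(** If [g] starts left of [c], both minors have a zero column. Otherwise border the minor by row [p]
    and column [c]: only the entries at [p] and [q] survive in that column, so the claim says that
    the bordered determinant is nonnegative. It is a minor of [A], or zero by a repeated column when
    [g] starts at [c]. *)
Lemma whitney_minor0 (K : numDomainType) (n : nat) (A : 'M[K]_n) (p q c : 'I_n)
    s (f g : 'I_s.+1 -> 'I_n) :
  totally_nonneg A -> pivot A p q c ->
  {homo f : i j / (i < j)%N} -> {homo g : i j / (i < j)%N} -> f ord0 = q ->
  A q c * \det (mxsub (upd f ord0 p) g A) <= A p c * \det (mxsub f g A).
Proof.
move=> hA [qp pc zc zl] hf hg fq.
have fp i : (p < f i)%N by have := homo_ge_ord0 i hf; rewrite fq qp.
case: (ltnP (g ord0) c) => [gc|cg].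
  rewrite !(@det_zero_col _ _ _ ord0) ?mulr0 // => i; rewrite !mxE zl //.
    exact: ltnW.
  by rewrite /upd; case: eqP => // _; exact: ltnW.
set W := mxsub (fcons p f) (fcons c g) A.
have dW : \det W = A p c * \det (mxsub f g A)
                   - A q c * \det (mxsub (upd f ord0 p) g A).
  rewrite (expand_det_col _ ord0) big_ord_recl big_ord_recl big1 => [|i _].
    rewrite addr0 !mxE !fcons0 !fconsS fq /cofactor /= addn0 expr0 mul1r.
    rewrite expr1 mulN1r mulrN; congr (_ * _ - _ * _); congr (\det _);
      apply/matrixP => a b; rewrite !mxE ?fconsS //.
    rewrite /upd; case: (unliftP ord0 a) => [a'|] ->.
      rewrite (_ : lift (lift ord0 ord0) (lift ord0 a') =
        lift ord0 (lift ord0 a')) ?fconsS //.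
      by apply: val_inj; rewrite /= /bump /=; lia.
    rewrite (_ : lift (lift ord0 ord0 : 'I_s.+2) (ord0 : 'I_s.+1) = ord0).
      by rewrite fcons0.
    exact: val_inj.
  by rewrite !mxE fconsS fcons0 zc ?mul0r // -fq; apply: hf.
suff : 0 <= \det W by rewrite dW subr_ge0.
move: cg; rewrite leq_eqVlt => /orP[/eqP/val_inj cg|cg].
  rewrite -det_tr (@determinant_alternate _ _ _ ord0 (lift ord0 ord0)) //.
  by move=> i; rewrite !mxE fcons0 fconsS cg.
apply: tnn_det hA _ _; apply: homo_fcons => // i.
exact: leq_trans cg (homo_ge_ord0 i hg).
Qed.

(* Deleting the row of the minor just above q reduces to f m being the first
   row, where the claim is the expansion of a minor along column c. *)
Lemma whitney_minor (K : numDomainType) (n : nat) (A : 'M[K]_n) (p q c : 'I_n)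
    s (f g : 'I_s -> 'I_n) (m : 'I_s) :
  totally_nonneg A -> pivot A p q c ->
  {homo f : i j / (i < j)%N} -> {homo g : i j / (i < j)%N} ->
  f m = q -> (forall i, f i != p) ->
  A q c * \det (mxsub (upd f m p) g A) <= A p c * \det (mxsub f g A).
Proof.
move=> hA hp; have [mm em] : exists mm, mm = m :> nat by exists m.
elim: mm s f g m em => [|k IH] [|s] f g m // em hf hg fm fp; try by case: m em fm.
  have m0 : m = ord0 by exact: val_inj.
  by rewrite m0 in fm *; exact: whitney_minor0 hA hp hf hg fm.
have [qp _ _ _] := hp.
have ks : (k < s.+1)%N by rewrite (leq_trans _ (ltn_ord m)) // -em.
pose k' := Ordinal ks.
have mk : m = k'.+1 :> nat by rewrite -em.
have km : k' != m by apply/eqP => e; move: mk; rewrite e; lia.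
set N := mxsub f g A; set P := mxsub (upd f m p) g A.
have [m' em' emm] : exists2 m' : 'I_s, k = m' :> nat & m = lift k' m'.
  case: (unliftP k' m) => [m' e|e]; last by rewrite e eqxx in km.
  by exists m' => //; move: mk; rewrite e /= /bump; lia.
(* The Pluecker relation will be divided by such a minor. If all of them vanish, expansion along row
   [k'] gives [\det P = 0] and the left side is zero. *)
have [/existsP[j nz]|/existsPn z] :=
    boolP [exists j, \det (row' k' (col' j P)) != 0]; last first.
  rewrite (expand_det_row P k') big1 => [|j _].
    by rewrite mulr0 mulr_ge0 ?tnn_ge0 // tnn_det.
  by have := z j; rewrite negbK /cofactor => /eqP ->; rewrite !mulr0.
have eN : row' k' (col' j N) = mxsub (f \o lift k') (g \o lift j) A.
  by apply/matrixP => a b; rewrite !mxE.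
have eP : row' k' (col' j P) = mxsub (upd (f \o lift k') m' p) (g \o lift j) A.
  by apply/matrixP => a b; rewrite !mxE /upd emm (inj_eq (@lift_inj _ k')).
have hfk : {homo f \o lift k' : i j / (i < j)%N}.
  by move=> a b ab; apply/hf/homo_lift.
have hgj : {homo g \o lift j : i j / (i < j)%N}.
  by move=> a b ab; apply/hg/homo_lift.
have fm' : (f \o lift k') m' = q by rewrite /= -emm.
have fpk i : (f \o lift k') i != p by exact: fp.
have := IH _ _ _ _ em' hfk hgj fm' fpk; rewrite -eN -eP => le1.
have fk : (f k' < p)%N.
  have : (f k' < f m)%N by apply: hf; rewrite mk.
  rewrite fm qp ltnS leq_eqVlt => /orP[/eqP/val_inj e|//].
  by have := fp k'; rewrite e eqxx.
have hfp : {homo upd f m p : i j / (i < j)%N}.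
  by apply: homo_upd hf _ fp; rewrite fm.
have hfkp : {homo upd f k' p : i j / (i < j)%N}.
  move=> a b ab; rewrite /upd; case: eqP => [ea|/eqP na]; case: eqP => [eb|/eqP nb].
  - by move: ab; rewrite ea eb ltnn.
  - have : (f m <= f b)%N.
      case: (ltngtP m b) => [/hf/ltnW //| |/val_inj -> //].
      by rewrite mk -ea; move: ab; lia.
    by rewrite fm qp.
  - by apply: leq_trans fk; rewrite ltnS; move: ab; rewrite eb => /hf/ltnW.
  - exact: hf.
have gt0 : 0 < \det (row' k' (col' j P)).
  rewrite lt0r nz eP tnn_det //; apply: homo_upd hfk _ fpk.
  by rewrite fm'.
(* Of the two terms of the Pluecker relation, the first is bounded below by the induction hypothesis
   [le1], and the second is a product of minors, hence nonnegative. *)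
rewrite -(ler_pM2r gt0) -[leRHS]mulrA (pluecker3 A f g j p mk) -/N -/P.
apply: (@le_trans _ _ (A p c * (\det (row' k' (col' j N)) * \det P))).
  rewrite mulrAC mulrA; apply: ler_wpM2r le1.
  exact: tnn_det.
rewrite ler_wpM2l ?tnn_ge0 // lerDl mulr_ge0 //; last exact: tnn_det.
rewrite (_ : row' m _ = mxsub (f \o lift m) (g \o lift j) A).
  by apply: tnn_det hA _ hgj => a b ab; apply/hf/homo_lift.
by apply/matrixP => a b; rewrite !mxE.
Qed.

Lemma neq_succ (n : nat) (p q : 'I_n) : q = p.+1 :> nat -> q != p.
Proof. by move=> qp; rewrite -val_eqE /= qp gtn_eqF. Qed.

(** * Elementary matrices and the Whitney reduction *)

Definition el (K : pzRingType) (n : nat) (q p : 'I_n) (t : K) : 'M[K]_n :=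
  1%:M + t *: delta_mx q p.

Lemma el_mulE (K : pzRingType) (n m : nat) (q p : 'I_n) (t : K) (A : 'M_(n, m)) a b :
  (el q p t *m A) a b = A a b + (t * A p b) *+ (a == q).
Proof.
rewrite /el mulmxDl mul1mx -scalemxAl !mxE; congr (_ + _).
rewrite (bigD1 p) //= big1 => [|i ip]; rewrite !mxE ?eqxx ?andbT ?addr0.
  by case: eqP => _; rewrite ?mul1r ?mul0r ?mulr0 ?mulr1n ?mulr0n.
by rewrite (negbTE ip) andbF mul0r.
Qed.

Lemma elK (K : comPzRingType) (n : nat) (q p : 'I_n) (t : K) :
  q != p -> el q p t *m el q p (- t) = 1%:M.
Proof.
move=> qp; rewrite /el mulmxDl mul1mx -scalemxAl mulmxDr mulmx1 -scalemxAr.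
rewrite mul_delta_mx_cond eq_sym (negbTE qp) mulr0n scaler0 addr0 scaleNr.
by rewrite -addrA addNr addr0.
Qed.

Lemma elNK (K : comPzRingType) (n : nat) (q p : 'I_n) (t : K) :
  q != p -> el q p (- t) *m el q p t = 1%:M.
Proof. by move=> qp; rewrite -{2}[t]opprK elK. Qed.

Lemma det_sub_el (K : comPzRingType) (n r : nat) (q p : 'I_n) (t : K) (A : 'M_n)
    (f g : 'I_r -> 'I_n) (i : 'I_r) :
  injective f -> f i = q ->
  \det (mxsub f g (el q p t *m A)) =
  \det (mxsub f g A) + t * \det (mxsub (upd f i p) g A).
Proof.
move=> fI fi; rewrite -[X in X + _]mul1r.
have row'_eq (M : 'M[K]_n) (f' : 'I_r -> 'I_n) :
    (forall j, j != i -> f' j = f j) -> (forall j x, j != i -> M (f j) x = A (f j) x) ->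
    row' i (mxsub f' g M) = row' i (mxsub f g A).
  move=> hf hM; apply/matrixP => a b.
  have ai : lift i a != i by rewrite eq_sym neq_lift.
  by rewrite !mxE hf // hM.
have hM j x : j != i -> (el q p t *m A) (f j) x = A (f j) x.
  by move=> ji; rewrite el_mulE -fi (inj_eq fI) (negbTE ji) addr0.
apply: (@determinant_multilinear _ _ _ _ _ i).
- apply/rowP => b; rewrite mxE mxE el_mulE fi eqxx !mxE /upd eqxx fi.
  by rewrite mul1r mulr1n.
- by apply/esym/row'_eq.
- rewrite (row'_eq A (upd f i p)) ?(row'_eq (el q p t *m A) f) // => j ji.
  by rewrite /upd (negbTE ji).
Qed.

Lemma det_sub_el_id (K : comPzRingType) (n r : nat) (q p : 'I_n) (t : K) (A : 'M_n)
    (f g : 'I_r -> 'I_n) :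
  (forall i, f i != q) ->
  \det (mxsub f g (el q p t *m A)) = \det (mxsub f g A).
Proof.
move=> fq; congr (\det _); apply/matrixP => a b.
by rewrite mxE el_mulE mxE (negbTE (fq a)) addr0.
Qed.

Lemma det_upd_dup (K : comPzRingType) (n r : nat) (p : 'I_n) (A : 'M[K]_n)
    (f g : 'I_r -> 'I_n) (i j : 'I_r) :
  i != j -> f j = p -> \det (mxsub (upd f i p) g A) = 0.
Proof.
move=> ij fj; apply: (determinant_alternate ij) => b.
by rewrite !mxE /upd eqxx eq_sym (negbTE ij) fj.
Qed.

(** A minor through row [q] gains [t] times the one with [q] replaced by [p]. As [p] and [q] are
    adjacent, this is again a minor with increasing rows, or zero when [p] already occurs. *)
Lemma tnn_el (K : numDomainType) (n : nat) (q p : 'I_n) (t : K) (A : 'M_n) :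
  q = p.+1 :> nat -> 0 <= t -> totally_nonneg A ->
  totally_nonneg (el q p t *m A).
Proof.
move=> qp t0 hA; apply: tnn_minors => r f g hf hg.
have [/existsP[i /eqP fi]|/existsPn fq] := boolP [exists i, f i == q]; last first.
  by rewrite det_sub_el_id // tnn_det.
rewrite (det_sub_el _ _ _ _ (homo_ord_inj hf) fi) addr_ge0 ?tnn_det // mulr_ge0 //.
have [/existsP[j /eqP fj]|/existsPn fp] := boolP [exists i, f i == p].
  rewrite (@det_upd_dup _ _ _ _ _ _ _ _ j) //.
  by apply/eqP => e; move: qp; rewrite -fi -fj e; lia.
by apply: tnn_det hA _ hg; apply: homo_upd hf _ fp; rewrite fi.
Qed.

(** Only minors that use row [q] and not row [p] can change, and for these [whitney_minor] is the
    required inequality. *)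
Lemma whitney (K : numFieldType) (n : nat) (A : 'M[K]_n) (p q c : 'I_n) :
  totally_nonneg A -> pivot A p q c ->
  totally_nonneg (el q p (- (A q c / A p c)) *m A).
Proof.
move=> hA hp; have [qp pc _ _] := hp.
apply: tnn_minors => r f g hf hg.
have [/existsP[i /eqP fi]|/existsPn fq] := boolP [exists i, f i == q]; last first.
  by rewrite det_sub_el_id // tnn_det.
rewrite (det_sub_el _ _ _ _ (homo_ord_inj hf) fi).
have [/existsP[j /eqP fj]|/existsPn fp] := boolP [exists i, f i == p].
  rewrite (@det_upd_dup _ _ _ _ _ _ _ _ j) ?mulr0 ?addr0 ?tnn_det //.
  by apply/eqP => e; move: qp; rewrite -fi -fj e; lia.
rewrite mulNr subr_ge0 mulrAC ler_pdivrMr // [leRHS]mulrC.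
exact: whitney_minor.
Qed.

(** * Pivots and induction along Whitney reductions *)

Definition upper (K : pzRingType) (n : nat) (A : 'M[K]_n) :=
  forall i j : 'I_n, (j < i)%N -> A i j = 0.

Definition lower (K : pzRingType) (n : nat) (A : 'M[K]_n) :=
  forall i j : 'I_n, (i < j)%N -> A i j = 0.

(** The termination measure: a reduction creates no nonzero entry and removes one. *)
Definition nz (K : pzRingType) (n : nat) (A : 'M[K]_n) : nat :=
  #|[set ij : 'I_n * 'I_n | A ij.1 ij.2 != 0]|.

(** If [A p c] were zero, the 2 by 2 minors on rows [p], [q] and columns [c < b] would force
    [A p b = 0], and row [p] would vanish entirely. *)
Lemma tnn_above_gt0 (K : numDomainType) (n : nat) (A : 'M[K]_n) (p q c : 'I_n) :
  totally_nonneg A -> \row_j A p j != 0 -> q = p.+1 :> nat -> 0 < A q c ->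
  (forall b : 'I_n, (b < c)%N -> A p b = 0) -> 0 < A p c.
Proof.
move=> hA Ap qp qc0 zp.
rewrite lt0r tnn_ge0 // andbT; apply/eqP => pc.
have rowp b : A p b = 0.
  case: (ltngtP b c) => [bc|cb|/val_inj -> //].
    exact: zp.
  pose f (x : 'I_2) := if x == ord0 then p else q.
  pose g (x : 'I_2) := if x == ord0 then c else b.
  have hf : {homo f : i j / (i < j)%N}.
    by case=> [[|[|//]] ?] [[|[|//]] ?] //= _; rewrite /f /= qp.
  have hg : {homo g : i j / (i < j)%N}.
    by case=> [[|[|//]] ?] [[|[|//]] ?].
  have := tnn_det hA hf hg; rewrite (expand_det_col _ ord0) !big_ord_recl big_ord0.
  rewrite /cofactor !det_mx11 !mxE /f /g /= pc mul0r add0r addr0 mulrA mulrN1.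
  rewrite mulNr oppr_ge0 => le0; apply: le_anti; rewrite tnn_ge0 // andbT.
  by rewrite -(pmulr_rle0 _ qc0).
by move/eqP: Ap; apply; apply/rowP => b; rewrite !mxE rowp.
Qed.

Lemma unit_row_neq0 (K : fieldType) (n : nat) (A : 'M[K]_n) (p : 'I_n) :
  A \in unitmx -> \row_j A p j != 0.
Proof.
move=> uA; apply/eqP => z; have : row p A *m invmx A = 0.
  by rewrite (_ : row p A = 0) ?mul0mx // -z; apply/rowP => b; rewrite !mxE.
rewrite -row_mul mulmxV // => /rowP/(_ p); rewrite !mxE eqxx.
by move/eqP; rewrite oner_eq0.
Qed.

(** Take [c] as the first column with a nonzero entry below the diagonal and [q] as the lowest row
    of such an entry. The last clause is stronger than what [pivot] records and also covers rows
    above [p]. *)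
Lemma exists_pivot (K : numFieldType) (n : nat) (A : 'M[K]_n) :
  totally_nonneg A -> A \in unitmx -> ~ upper A ->
  exists p q c, [/\ pivot A p q c, 0 < A q c, (c < q)%N
    & forall a b : 'I_n, (b < c)%N -> (b < a)%N -> A a b = 0].
Proof.
move=> hA uA nup.
pose bad (c : 'I_n) := [exists i : 'I_n, (c < i)%N && (A i c != 0)].
have [c0 bc0] : exists c, bad c.
  apply/existsP; apply: contra_notT nup => /existsPn h i j ij.
  by have := h j; move/existsPn => /(_ i); rewrite ij negbK => /eqP.
case: (@arg_minnP _ _ bad (fun c : 'I_n => nat_of_ord c) bc0) => c bc cmin.
case/existsP: bc => q0 hq0.
case: (@arg_maxnP _ q0 (fun q => (c < q)%N && (A q c != 0))
  (fun c : 'I_n => nat_of_ord c) hq0) => q /andP[cq qc] qmax.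
have zl (a b : 'I_n) : (b < c)%N -> (b < a)%N -> A a b = 0.
  move=> bc ba; apply/eqP; apply: contraTT bc => nzab; rewrite -leqNgt.
  by apply: cmin; apply/existsP; exists a; rewrite ba.
have zc (a : 'I_n) : (q < a)%N -> A a c = 0.
  move=> qa; apply/eqP; apply/negPn/negP => nza.
  have := qmax a; rewrite nza (ltn_trans cq qa) => /(_ isT).
  by rewrite /geq /= leqNgt qa.
have pn : (q.-1 < n)%N by have := ltn_ord q; lia.
pose p := Ordinal pn.
have qp : q = p.+1 :> nat by rewrite /=; lia.
have cp : (c <= p)%N by move: cq; rewrite qp ltnS.
have qc0 : 0 < A q c by rewrite lt0r qc tnn_ge0.
exists p, q, c; split=> //; split=> //; last first.
  by move=> a b bc pa; apply: zl => //; lia.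
apply: tnn_above_gt0 hA (unit_row_neq0 p uA) qp qc0 _ => b bc.
by apply: zl => //; lia.
Qed.

(** A sum of nonnegative terms vanishes only termwise. With [A] the reduced matrix, this says that a
    reduction keeps all zeros. *)
Lemma el_ge0_eq0 (K : numDomainType) (n : nat) (q p i j : 'I_n) (t : K)
    (A : 'M[K]_n) :
  0 <= t -> totally_nonneg A -> (el q p t *m A) i j = 0 -> A i j = 0.
Proof.
move=> t0 hA /eqP; rewrite el_mulE paddr_eq0 ?tnn_ge0 // => [/andP[/eqP //]|].
by rewrite mulrn_wge0 // mulr_ge0 // tnn_ge0.
Qed.

Lemma nz_lt (K : pzRingType) (n : nat) (A B : 'M[K]_n) a b :
  (forall i j, A i j = 0 -> B i j = 0) -> A a b != 0 -> B a b = 0 ->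
  (nz B < nz A)%N.
Proof.
move=> AB nzA zB; apply/proper_card/properP; split.
  apply/fintype.subsetP => -[i j]; rewrite !inE /=; apply: contra_neq; exact: AB.
by exists (a, b); rewrite !inE /= ?zB ?eqxx.
Qed.

Lemma el_unit (K : comUnitRingType) (n : nat) (q p : 'I_n) (t : K) :
  q != p -> el q p t \in unitmx.
Proof. by move=> qp; have := mulmx1_unit (elK t qp) => -[]. Qed.

(** Each reduction writes the matrix as an elementary factor times one with fewer nonzero entries,
    until an upper triangular matrix is left. *)
Lemma tnn_ind (K : numFieldType) (n : nat) (P : 'M[K]_n -> Prop) :
  (forall A, totally_nonneg A -> A \in unitmx -> upper A -> P A) ->
  (forall (p q : 'I_n) t A, q = p.+1 :> nat -> 0 <= t -> totally_nonneg A ->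
    A \in unitmx -> P A -> P (el q p t *m A)) ->
  forall A, totally_nonneg A -> A \in unitmx -> P A.
Proof.
move=> Pup Pel A; have [m] := ubnP (nz A); elim: m A => // m IH A Am hA uA.
have [up|nup] := pselect (upper A); first exact: Pup.
have [p [q [c [pv qc cq _]]]] := exists_pivot hA uA nup.
have [qp pc _ _] := pv; set t := A q c / A p c.
have t0 : 0 <= t by rewrite divr_ge0 // ltW.
have nqp : q != p by exact: neq_succ.
have hB := whitney hA pv; rewrite -/t in hB.
have eA : A = el q p t *m (el q p (- t) *m A) by rewrite mulmxA elK // mul1mx.
rewrite eA; apply: Pel => //.
  by rewrite unitmx_mul el_unit.
apply: IH => //; last by rewrite unitmx_mul el_unit.
rewrite ltnS in Am; apply: leq_trans Am.
apply: (@nz_lt _ _ _ _ q c) => [i j|| ]; last 1 first.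
- by rewrite el_mulE eqxx mulr1n /t mulNr divfK ?subrr // gt_eqF.
- by rewrite {1}eA; apply: el_ge0_eq0.
- by rewrite gt_eqF.
Qed.

(** * The form Omega and the involution tau *)

Lemma signr_parity (R : pzRingType) (a b : nat) :
  odd a = odd b -> (-1) ^+ a = (-1) ^+ b :> R.
Proof. by move=> e; rewrite -signr_odd e signr_odd. Qed.

Lemma OmegaE (K : pzRingType) (n : nat) (i j : 'I_n) :
  Omega K n i j = (-1) ^+ i *+ (j == rev_ord i).
Proof.
rewrite /Omega summxE (bigD1_seq i.+1) ?mem_index_iota ?iota_uniq //=; last first.
  by rewrite ltnS ltn_ord.
rewrite big1 => [|k ki]; last first.
  by rewrite !mxE eq_sym (negbTE ki) mulr0.
rewrite !mxE eqxx addr0 /= !exprS !mulN1r opprK subSS.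
have -> : (j.+1 == n - i)%N = (j == rev_ord i).
  by rewrite -val_eqE /=; have := ltn_ord i; lia.
by case: eqP; rewrite ?mulr1 ?mulr0.
Qed.

Lemma Omega_tr (K : pzRingType) (n : nat) :
  (Omega K n)^T = (-1) ^+ n.+1 *: Omega K n.
Proof.
apply/matrixP => i j; rewrite !mxE !OmegaE (eq_sym i) -(inj_eq rev_ord_inj) rev_ordK.
case: eqP => [->|]; rewrite ?mulr0n ?mulr0 // !mulr1n.
rewrite -exprD; apply: signr_parity.
by rewrite /=; have := ltn_ord i; lia.
Qed.

Lemma Omega_sqr (K : comPzRingType) (n : nat) :
  Omega K n *m Omega K n = (-1) ^+ n.+1 *: 1%:M.
Proof.
apply/matrixP => i j; rewrite !mxE (bigD1 (rev_ord i)) //= big1 => [|k ki].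
  rewrite !OmegaE eqxx rev_ordK mulr1n addr0 eq_sym mulrnAr -exprD.
  rewrite mulr_natr; congr (_ *+ _).
  apply: signr_parity.
  by rewrite /=; have := ltn_ord i; lia.
by rewrite OmegaE (negbTE ki) mul0r.
Qed.

Lemma Omega_unit (K : comUnitRingType) (n : nat) : Omega K n \in unitmx.
Proof.
have : Omega K n *m ((-1) ^+ n.+1 *: Omega K n) = 1%:M.
  by rewrite -scalemxAr Omega_sqr scalerA -exprMn mulrN1 opprK expr1n scale1r.
by case/mulmx1_unit.
Qed.

(* tau A B says that B is the image of A under the involution
   A |-> (Omega^-1 A^-1 Omega)^T whose fixed points form G(Omega). *)
Definition tau (K : pzRingType) (n : nat) (A B : 'M[K]_n) : Prop :=
  A *m Omega K n *m B^T = Omega K n.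

Lemma tau_mul (K : comPzRingType) (n : nat) (A A' B B' : 'M[K]_n) :
  tau A A' -> tau B B' -> tau (A *m B) (A' *m B').
Proof.
move=> hA hB; rewrite /tau trmx_mul -!mulmxA (mulmxA (Omega _ _)) (mulmxA B).
by rewrite (mulmxA B) hB mulmxA.
Qed.

Lemma tau_sym (K : comPzRingType) (n : nat) (A B : 'M[K]_n) :
  tau A B -> tau B A.
Proof.
move=> /(congr1 trmx); rewrite !trmx_mul trmxK Omega_tr -scalemxAl -scalemxAr.
move=> /(congr1 ( *:%R ((-1) ^+ n.+1))).
by rewrite !scalerA -exprMn mulrN1 opprK expr1n !scale1r mulmxA.
Qed.

Lemma tau_tr (K : comUnitRingType) (n : nat) (A B : 'M[K]_n) :
  tau A B -> tau B^T A^T.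
Proof.
rewrite /tau trmxK => h; set s : K := (-1) ^+ n.+1.
have ss : s * s = 1 by rewrite -exprMn mulrN1 opprK expr1n.
have OO : Omega K n *m (s *: Omega K n) = 1%:M.
  by rewrite -scalemxAr Omega_sqr scalerA ss scale1r.
(* The right inverse of [A] read off from the relation is also a left inverse, which moves [A] to
   the other end of the product. *)
have : A *m (Omega K n *m B^T *m (s *: Omega K n)) = 1%:M by rewrite !mulmxA h.
move/mulmx1C => h1.
transitivity (s *: (s *: (B^T *m Omega K n *m A))); first by rewrite scalerA ss scale1r.
transitivity (s *: (s *: Omega K n)); last by rewrite scalerA ss scale1r.
congr (_ *: _); rewrite -[RHS]mulmx1 -h1 -!mulmxA [RHS]mulmxA (mulmx1C OO) mul1mx.
by rewrite -scalemxAl -scalemxAr.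
Qed.

Lemma tau_unit (K : comUnitRingType) (n : nat) (A B : 'M[K]_n) :
  tau A B -> A \in unitmx.
Proof.
move=> h; have : A *m (Omega K n *m B^T *m invmx (Omega K n)) = 1%:M.
  by rewrite !mulmxA h mulmxV // Omega_unit.
by case/mulmx1_unit.
Qed.

(** [Omega] carries both matrix units to the same position with signs [(-1) ^+ p] and [(-1) ^+ q].
    These are opposite for adjacent rows, so the linear terms cancel; the quadratic term vanishes
    because [p] and [q] differ. *)
Lemma tau_el (K : comPzRingType) (n : nat) (p q : 'I_n) (t : K) :
  q = p.+1 :> nat -> tau (el q p t) (el (rev_ord p) (rev_ord q) t).
Proof.
move=> qp; rewrite /tau /el linearD /= trmx1 linearZ /= trmx_delta.
rewrite mulmxDl mul1mx mulmxDr mulmx1 mulmxDl.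
set D := delta_mx q p; set D' := delta_mx _ _.
have DO : D *m Omega K n = (-1) ^+ p *: delta_mx q (rev_ord p).
  apply/matrixP => i j; rewrite !mxE (bigD1 p) //= big1 => [|k kp].
    rewrite OmegaE !mxE eqxx andbT addr0; case: (i == q); case: (j == _);
      by rewrite /= ?mulr0n ?mulr1n ?mul0r ?mulr0 ?mul1r ?mulr1.
  by rewrite !mxE (negbTE kp) andbF mul0r.
have OD : Omega K n *m D' = (-1) ^+ q *: delta_mx q (rev_ord p).
  apply/matrixP => i j; rewrite !mxE (bigD1 (rev_ord q)) //= big1 => [|k kq].
    rewrite OmegaE !mxE eqxx addr0 (inj_eq rev_ord_inj) (eq_sym q).
    case: eqP => [->|_]; case: (j == _);
      by rewrite /= ?mulr0n ?mulr1n ?mul0r ?mulr0 ?mulr1.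
  by rewrite !mxE (negbTE kq) mulr0.
rewrite -!scalemxAl -!scalemxAr DO OD -?scalemxAl mul_delta_mx_cond.
have -> : (rev_ord p == rev_ord q) = false.
  by rewrite (inj_eq rev_ord_inj); apply/eqP => e; move: qp; rewrite e; lia.
by rewrite mulr0n !scaler0 addr0 qp exprS mulN1r scaleNr scalerN addrK.
Qed.

Lemma el_rev_lt (n : nat) (p q : 'I_n) :
  q = p.+1 :> nat -> rev_ord p = (rev_ord q).+1 :> nat.
Proof. by move=> /= qp; have := ltn_ord q; lia. Qed.

(** * Total nonnegativity is preserved by tau *)

Lemma tnn_diag (K : numDomainType) (n : nat) (A : 'M[K]_n) :
  is_diag_mx A -> (forall i, 0 <= A i i) -> totally_nonneg A.
Proof.
move=> /is_diag_mxP dA A0; apply: tnn_minors => r; elim: r => [|r IH] f g hf hg.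
  by rewrite det_mx00.
have hl (r' n' : nat) (h : 'I_r'.+1 -> 'I_n') :
    {homo h : i j / (i < j)%N} -> {homo h \o lift ord0 : i j / (i < j)%N}.
  by move=> hh a b ab; apply/hh/homo_lift.
(* If the first row and column indices differ, the smaller one belongs to a zero row or column of
   the minor. *)
case: (ltngtP (f ord0) (g ord0)) => [fg|gf|/val_inj fg].
- rewrite -det_tr (@det_zero_col _ _ _ ord0) // => i.
  rewrite !mxE dA //; apply/eqP => e.
  by have := homo_ge_ord0 i hg; rewrite leqNgt -e fg.
- rewrite (@det_zero_col _ _ _ ord0) // => i.
  rewrite !mxE dA //; apply/eqP => e.
  by have := homo_ge_ord0 i hf; rewrite leqNgt e gf.
rewrite (expand_det_col _ ord0) big_ord_recl big1 => [|i _]; last first.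
  rewrite !mxE dA ?mul0r // -fg; apply/eqP => e.
  have : (f ord0 < f (lift ord0 i))%N by apply: hf.
  by rewrite e ltnn.
rewrite addr0 !mxE fg mulr_ge0 // /cofactor expr0 mul1r.
rewrite (_ : row' _ _ = mxsub (f \o lift ord0) (g \o lift ord0) A).
  by apply: IH; exact: hl.
by apply/matrixP => a b; rewrite !mxE.
Qed.

(** For diagonal [A] every entry of the defining relation has a single term; it forces [B] to be
    diagonal with the inverse entries in reversed order. *)
Lemma tau_diag (K : numFieldType) (n : nat) (A B : 'M[K]_n) :
  is_diag_mx A -> tau A B -> forall i j, A i i * B j (rev_ord i) = (j == rev_ord i)%:R.
Proof.
move=> /is_diag_mxP dA h i j;
  have := congr1 (fun M : 'M_n => (-1) ^+ i * M i j) (h : _ *m _ *m _ = _).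
rewrite !mxE (bigD1 (rev_ord i)) //= big1 => [|k ki]; last first.
  rewrite !mxE (bigD1 i) //= big1 => [|l li].
    by rewrite OmegaE (negbTE ki) mulr0n mulr0 addr0 mul0r.
  by rewrite dA ?mul0r // eq_sym.
rewrite addr0 !mxE (bigD1 i) //= big1 => [|l li]; last first.
  by rewrite dA ?mul0r // eq_sym.
have ss : (-1) ^+ i * (-1) ^+ i = 1 :> K by rewrite -exprMn mulrN1 opprK expr1n.
rewrite !OmegaE eqxx mulr1n addr0 -mulr_natr (mulrA _ _ (_%:R)) ss mul1r => <-.
rewrite -[LHS]mul1r -[X in X * _ = _]ss; ring.
Qed.

(** By [tau_el] the new factor appears in the tau-image as an elementary factor at the reflected
    rows with the same nonnegative parameter, so [tnn_el] applies. *)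
Lemma tau_tnn_el (K : numDomainType) (n : nat) (p q : 'I_n) (t : K) (A : 'M_n) :
  q = p.+1 :> nat -> 0 <= t -> (forall B, tau A B -> totally_nonneg B) ->
  forall B, tau (el q p t *m A) B -> totally_nonneg B.
Proof.
move=> qp t0 IH B hB.
have nqp : q != p by exact: neq_succ.
have hA' := tau_mul (tau_el (- t) qp) hB.
rewrite mulmxA elNK // mul1mx in hA'.
set rq := rev_ord q in hA'; set rp := rev_ord p in hA'.
have rpq : rp != rq by rewrite (inj_eq rev_ord_inj) eq_sym.
rewrite (_ : B = el rp rq t *m (el rp rq (- t) *m B)); last first.
  by rewrite mulmxA elK // mul1mx.
by apply: tnn_el => //; [exact: el_rev_lt|exact: IH].
Qed.

(** Reductions keep a lower triangular matrix lower triangular, so the upper triangular matrix at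
    the end of the induction is diagonal. *)
Lemma tau_tnn_lower (K : numFieldType) (n : nat) (A : 'M[K]_n) :
  totally_nonneg A -> A \in unitmx ->
  lower A -> forall B, tau A B -> totally_nonneg B.
Proof.
move: A; apply: (@tnn_ind _ _
  (fun A => lower A -> forall B, tau A B -> totally_nonneg B)).
  move=> A hA uA up lo B hAB.
  have dA : is_diag_mx A.
    by apply/is_diag_mxP => i j; rewrite neq_ltn => /orP[/lo|/up].
  have AB := tau_diag dA hAB.
  have A0 i : 0 < A i i.
    rewrite lt0r tnn_ge0 // andbT; apply/eqP => e.
    by have := AB i (rev_ord i); rewrite e mul0r eqxx => /esym/eqP; rewrite oner_eq0.
  apply: tnn_diag => [|i].
    apply/is_diag_mxP => i j ij; have := AB (rev_ord j) i; rewrite rev_ordK.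
    rewrite (_ : (i == j) = false); last exact/negbTE.
    by move/eqP; rewrite mulf_eq0 gt_eqF //= => /eqP.
  have := AB (rev_ord i) i; rewrite rev_ordK eqxx => e.
  by rewrite -(pmulr_rge0 _ (A0 (rev_ord i))) e ler01.
move=> p q t A qp t0 hA uA IH lo; apply: tau_tnn_el => //; apply: IH.
by move=> i j ij; apply: (el_ge0_eq0 t0 hA); exact: lo ij.
Qed.

(** Reductions lead to an upper triangular matrix, whose transpose falls under [tau_tnn_lower]. *)
Lemma tau_tnn (K : numFieldType) (n : nat) (A B : 'M[K]_n) :
  totally_nonneg A -> tau A B -> totally_nonneg B.
Proof.
move=> hA hAB; have uA := tau_unit hAB.
move: A hA uA B hAB; apply: (@tnn_ind _ _
  (fun A => forall B, tau A B -> totally_nonneg B)).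
  move=> A hA uA up B hB; rewrite -[B]trmxK; apply: tnn_tr.
  apply: (@tau_tnn_lower _ _ A^T); rewrite ?unitmx_tr //; first exact: tnn_tr.
    by move=> i j ij; rewrite mxE up.
  exact/tau_sym/tau_tr.
by move=> p q t A qp t0 _ _; exact: tau_tnn_el.
Qed.

(** * Splitting one generator off a tau-fixed matrix *)

Lemma tau_sum (K : pzRingType) (n : nat) (A B : 'M[K]_n) (i j : 'I_n) :
  tau A B ->
  \sum_k A i k * (-1) ^+ k * B j (rev_ord k) = (-1) ^+ i *+ (j == rev_ord i).
Proof.
move=> h; rewrite -OmegaE -[in RHS](h : _ *m _ *m _ = _) !mxE.
rewrite [RHS](reindex_inj rev_ord_inj) /=; apply: eq_bigr => k _.
rewrite !mxE (bigD1 k) //= big1 => [|l lk].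
  by rewrite OmegaE eqxx addr0.
by rewrite OmegaE (inj_eq rev_ord_inj) eq_sym (negbTE lk) mulr0n mulr0.
Qed.

Lemma el_comm (K : comPzRingType) (n : nat) (q p q' p' : 'I_n) (s t : K) :
  p != q' -> p' != q -> el q p s *m el q' p' t = el q' p' t *m el q p s.
Proof.
move=> h h'; rewrite /el !mulmxDl !mulmxDr !mul1mx !mulmx1 -!scalemxAl -!scalemxAr.
rewrite !mul_delta_mx_cond (negbTE h) (negbTE h') !mulr0n !scaler0 !addr0.
by rewrite -!addrA; congr (_ + _); rewrite addrC.
Qed.

(** In the case of interest the right side is the exponential of [2%:R * t] times the sum of the two
    matrix units, whose square is [delta_mx q u]. *)
Lemma el3 (K : comPzRingType) (n : nat) (q p u : 'I_n) (t : K) :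
  q != p -> p != u -> q != u ->
  el p u t *m el q p (2%:R * t) *m el p u t =
  1%:M + (2%:R * t) *: (delta_mx p u + delta_mx q p)
    + (2%:R * t ^+ 2) *: delta_mx q u.
Proof.
move=> qp pu qu; rewrite /el !mulmxDl !mulmxDr !mul1mx !mulmx1.
rewrite -!scalemxAl -!scalemxAr mulmxDl -!scalemxAl !mul_delta_mx_cond.
rewrite eqxx (eq_sym u q) (negbTE qu) mulr0n mulr1n !scaler0 addr0 mul1mx.
rewrite -scalemxAl mul_delta_mx_cond eq_sym (negbTE pu) mulr0n !scaler0 addr0.
apply/matrixP => i j; rewrite !mxE; ring.
Qed.

(** When [p] is the middle row, tau exchanges the two kinds of factors, so this identity makes the
    short generator tau-fixed. *)
Lemma el3_sym (K : comPzRingType) (n : nat) (q p u : 'I_n) (t : K) :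
  q != p -> p != u -> q != u ->
  el q p t *m el p u (2%:R * t) *m el q p t =
  el p u t *m el q p (2%:R * t) *m el p u t.
Proof.
move=> qp pu qu; rewrite el3 // /el !mulmxDl !mulmxDr !mul1mx !mulmx1.
rewrite -!scalemxAl -!scalemxAr mulmxDl -!scalemxAl !mul_delta_mx_cond.
rewrite eqxx (eq_sym u q) (negbTE qu) !mulr0n !mulr1n !scaler0 ?addr0 mul1mx.
rewrite mulmxDl -!scalemxAl !mul_delta_mx_cond (eq_sym p q) (eq_sym u q).
rewrite (negbTE qp) (negbTE qu) !mulr0n !scaler0 ?addr0.
apply/matrixP => i j; rewrite !mxE; ring.
Qed.

(* The generators X_{-i}(t) as products of elementary matrices, indexed by rows
   instead of by i; LowerLong and LowerShort are X_{-k} for n even and n odd. *)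
Inductive lower_gen (K : comPzRingType) (n : nat) : K -> 'M[K]_n -> Prop :=
| LowerPair (p q : 'I_n) t : q = p.+1 :> nat ->
    rev_ord q != p -> rev_ord q != q -> rev_ord p != p ->
    lower_gen t (el (rev_ord p) (rev_ord q) t *m el q p t)
| LowerLong (p q : 'I_n) t : q = p.+1 :> nat -> rev_ord q = p ->
    lower_gen t (el q p t)
| LowerShort (u p q : 'I_n) t : p = u.+1 :> nat -> q = p.+1 :> nat ->
    rev_ord p = p ->
    lower_gen t (el p u t *m el q p (2%:R * t) *m el p u t).

Lemma ord_eqS (n : nat) (p q a : 'I_n) :
  q = p.+1 :> nat -> (p < a)%N -> (a <= q)%N -> a = q.
Proof. by move=> qp pa aq; apply/ord_inj/eqP; rewrite eqn_leq aq qp. Qed.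

Lemma rev_ord_lt (n : nat) (i j : 'I_n) :
  (rev_ord j < rev_ord i)%N = (i < j)%N.
Proof. by rewrite /=; have := ltn_ord i; have := ltn_ord j; lia. Qed.

Lemma lower_step (K : numFieldType) (n : nat) (A : 'M[K]_n) :
  totally_nonneg A -> tau A A -> ~ upper A ->
  exists t X B, [/\ 0 < t, lower_gen t X, A = X *m B, totally_nonneg B & tau B B]
    /\ (forall i j, A i j = 0 -> B i j = 0) /\ (nz B < nz A)%N.
Proof.
move=> hA tA nup; have uA := tau_unit tA.
have [p [q [c [pv qc cq zu]]]] := exists_pivot hA uA nup.
have [qp pc zc zl] := pv; set t := A q c / A p c.
have t0 : 0 < t by rewrite divr_gt0.
have nqp : q != p by exact: neq_succ.
have hA1 := whitney hA pv; rewrite -/t in hA1; set A1 := _ *m A in hA1.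
pose q' := rev_ord p; pose p' := rev_ord q.
have qp' : q' = p'.+1 :> nat := el_rev_lt qp.
have nqp' : q' != p' by exact: neq_succ.
(* [S1] is the tau-image of the reduced matrix [A1]; its total nonnegativity is the source of all
   further constraints. *)
pose S1 := el q' p' (- t) *m A.
have tA1 : tau A1 S1 := tau_mul (tau_el (- t) qp) tA.
have hS1 : totally_nonneg S1 := tau_tnn hA1 tA1.
have eA1 : A = el q p t *m A1 by rewrite mulmxA elK // mul1mx.
have eS1 : A = el q' p' t *m S1 by rewrite mulmxA elK // mul1mx.
have zS1 i j : A i j = 0 -> S1 i j = 0.
  by rewrite {1}eS1; apply: el_ge0_eq0 => //; exact: ltW.
have qcn : A q c != 0 by rewrite gt_eqF.
(* Here reflection maps the pair of rows [p], [q] to itself, so [A1] and [S1] coincide and a long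
   factor splits off. *)
have [e|p'p] := eqVneq p' p.
  have q'q : q' = q by apply: ord_inj; rewrite qp' e qp.
  exists t, (el q p t), A1; split; last split.
  - by split=> //; [exact: LowerLong|move: tA1; rewrite /S1 q'q e].
  - by move=> i j; rewrite {1}eA1; apply: el_ge0_eq0 => //; exact: ltW.
  - apply: (@nz_lt _ _ _ _ q c) => // [i j|].
      by rewrite {1}eA1; apply: el_ge0_eq0 => //; exact: ltW.
    by rewrite el_mulE eqxx mulr1n /t mulNr divfK ?subrr // gt_eqF.
(* Here [q] would be the middle row and [q'] the row below it, where column [c] of [A] is zero; then
   [S1] would have a negative entry. *)
have [e|p'q] := eqVneq p' q.
  have := tnn_ge0 q' c hS1; rewrite el_mulE eqxx mulr1n zc ?qp' ?e //.
  by rewrite add0r mulNr oppr_ge0 => /le_gtF; rewrite mulr_gt0.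
(* If also [q'] differs from [p], passing to [S1] leaves rows [p] and [q] untouched. The same pivot
   with the same [t] then reduces [S1], and the two elementary factors commute. *)
have [e|q'p] := eqVneq q' p; last first.
  have q'q : q' != q.
    by apply: contraNneq p'p => e; apply/eqP/ord_inj; move: qp'; rewrite e qp => -[].
  have S1p : S1 p c = A p c by rewrite el_mulE eq_sym (negbTE q'p) addr0.
  have S1q : S1 q c = A q c by rewrite el_mulE eq_sym (negbTE q'q) addr0.
  have pvS : pivot S1 p q c.
    by split=> // [|a qa|a b bc pa]; rewrite ?S1p //; apply: zS1; [exact: zc|exact: zl].
  have := whitney hS1 pvS; rewrite S1p S1q -/t; set C := _ *m S1 => hC.
  have eC : S1 = el q p t *m C by rewrite mulmxA elK // mul1mx.
  have zC i j : A i j = 0 -> C i j = 0.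
    by move/zS1; rewrite {1}eC; apply: el_ge0_eq0 => //; exact: ltW.
  exists t, (el q' p' t *m el q p t), C; split; last split=> //.
  - split=> //; first exact: LowerPair.
      by rewrite -mulmxA -eC.
    have := tau_mul (tau_el (- t) qp) (tau_sym tA1); rewrite -/q' -/p' -/C.
    rewrite (_ : el q' p' _ *m A1 = C) // /C /A1 /S1 !mulmxA el_comm //.
    by rewrite eq_sym.
  - apply: (@nz_lt _ _ _ _ q c) => //.
    by rewrite el_mulE eqxx mulr1n S1q S1p /t mulNr divfK ?subrr // gt_eqF.
(* The remaining case: [p] is the middle row, and [u], [p], [q] are consecutive. *)
have pu : p = p'.+1 :> nat by rewrite -{1}e.
move: hS1 tA1 eS1 zS1; rewrite /S1 e; set u := p' in pu *.
clear S1; set S1 := _ *m A => hS1 tA1 eS1 zS1.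
have npu : p != u by exact: neq_succ.
have nqu : q != u
  by apply/eqP => E; have : (u < q)%N by [rewrite qp pu ltnW]; rewrite E ltnn.
have rq : rev_ord q = u by [].
have ru : rev_ord u = q by rewrite rev_ordK.
have tau_p (s : K) : tau (el q p s) (el p u s).
  by have := tau_el s qp; rewrite (e : rev_ord p = p).
have cp : (c < p)%N.
  move: cq; rewrite qp ltnS leq_eqVlt => /orP[/eqP/ord_inj cp|//].
  (* a pivot in the middle column contradicts isotropy of the rows p and q *)
  have := tau_sum q p tA; rewrite (bigD1 p) //= big1 => [|k kp].
    rewrite (e : rev_ord p = p) rq (negbTE npu) addr0 mulr0n.
    have qp0 : A q p != 0 by rewrite -cp.
    have pp0 : A p p != 0 by rewrite -{2}cp gt_eqF.
    by move/eqP; rewrite !mulf_eq0 signr_eq0 (negbTE qp0) (negbTE pp0).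
  case: (ltngtP k p) => [kp'|pk|/ord_inj E]; last by rewrite E eqxx in kp.
    by rewrite zu ?mul0r ?cp // qp ltnS ltnW.
  have rk : (rev_ord k < p)%N.
    by rewrite -(e : rev_ord p = p) rev_ord_lt.
  by rewrite [A p _]zu ?mulr0 ?cp.
have tau_u (s : K) : tau (el p u s) (el q p s) by exact: tau_sym.
have unit_S1 : S1 \in unitmx := tau_unit (tau_sym tA1).
have S1q : S1 q c = A q c by rewrite el_mulE (negbTE nqp) addr0.
have S1u : S1 u c = A u c by rewrite el_mulE eq_sym (negbTE npu) addr0.
have S1p : S1 p c = A p c - t * A u c by rewrite el_mulE eqxx mulr1n mulNr.
have S1p0 : 0 < S1 p c.
  apply: (tnn_above_gt0 hS1 (unit_row_neq0 p unit_S1) qp); rewrite ?S1q // => b bc.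
  exact/zS1/zl.
have pvS1 : pivot S1 p q c.
  by split=> // [a qa|a b bc pa]; apply: zS1; [exact: zc|exact: zl].
(* The second reduction, at rows [p], [q] of [S1], has its own parameter [t']; its tau-image [S2] is
   a reduction of [A1] at rows [u], [p]. *)
have := whitney hS1 pvS1; rewrite S1q; set t' := A q c / S1 p c.
have t'0 : 0 < t' by rewrite divr_gt0.
set A2 := _ *m S1 => hA2.
have eA2 : S1 = el q p t' *m A2 by rewrite mulmxA elK // mul1mx.
have zA2 i j : A i j = 0 -> A2 i j = 0.
  by move/zS1; rewrite {1}eA2; apply: el_ge0_eq0 => //; exact: ltW.
pose S2 := el p u (- t') *m A1.
have tA2 : tau A2 S2 by apply: tau_mul; [exact: tau_p|exact: tau_sym].
have hS2 : totally_nonneg S2 := tau_tnn hA2 tA2.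
have A2q : A2 q c = 0.
  by rewrite el_mulE eqxx mulr1n S1q mulNr divfK ?subrr // gt_eqF.
have A2p : A2 p c = S1 p c by rewrite el_mulE eq_sym (negbTE nqp) addr0.
have A2u : A2 u c = A u c by rewrite el_mulE eq_sym (negbTE nqu) addr0 S1u.
have zA1 i j : A i j = 0 -> A1 i j = 0.
  by rewrite {1}eA1; apply: el_ge0_eq0 => //; exact: ltW.
have zS2 i j : A i j = 0 -> S2 i j = 0.
  move/zA1; rewrite (_ : A1 = el p u t' *m S2); last by rewrite mulmxA elK // mul1mx.
  by apply: el_ge0_eq0 => //; exact: ltW.
have S2p : S2 p c = A p c - t' * A u c.
  rewrite el_mulE eqxx mulr1n !el_mulE eq_sym (negbTE nqp) addr0.
  by rewrite (eq_sym u) (negbTE nqu) addr0 mulNr.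
have S2u : S2 u c = A u c.
  rewrite el_mulE (eq_sym u) (negbTE npu) addr0 el_mulE (eq_sym u) (negbTE nqu).
  by rewrite addr0.
have S2q : S2 q c = 0.
  rewrite el_mulE (negbTE nqp) addr0 el_mulE eqxx mulr1n mulNr divfK ?subrr //.
  by rewrite gt_eqF.
have zlu (a b : 'I_n) : (b < c)%N -> (u <= a)%N -> A a b = 0.
  move=> bc ua; apply: zu => //.
  by rewrite (leq_trans bc) // (leq_trans _ ua) // -ltnS -pu.
(* Otherwise [S2] could be reduced once more at rows [u], [p]. The tau-image of the result subtracts
   a positive multiple of row [p] from row [q] of [A2], where [A2 q c = 0] and [A2 p c] is positive,
   producing a negative entry. *)
have S2p_eq0 : S2 p c = 0.
  apply/eqP; apply/negPn/negP => S2p_neq0.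
  have S2p0 : 0 < S2 p c by rewrite lt0r S2p_neq0 tnn_ge0.
  have S2u0 : 0 < S2 u c.
    apply: (tnn_above_gt0 hS2 (unit_row_neq0 u _) pu S2p0) => [|b bc].
      exact: tau_unit (tau_sym tA2).
    exact/zS2/zlu.
  have pvS2 : pivot S2 u p c.
    split=> // [a pa|a b bc ua]; last exact/zS2/zlu.
    have [qa|aq] := ltnP q a; first exact/zS2/zc.
    by rewrite (ord_eqS qp pa aq).
  have := tau_tnn (whitney hS2 pvS2) (tau_mul (tau_u _) (tau_sym tA2)).
  move/(@tnn_ge0 _ _ _ q c); rewrite el_mulE eqxx mulr1n A2q A2p add0r mulNr oppr_ge0.
  by move/le_gtF; rewrite mulr_gt0 // divr_gt0.
have Ap : A p c = t' * A u c by apply/eqP; rewrite -subr_eq0 -S2p S2p_eq0.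
have Au0 : 0 < A u c by move: pc; rewrite Ap pmulr_rgt0.
(* Both [t' * S1 p c] and [t * A p c] equal [A q c]; substituting [A p c = t' * A u c] leaves
   [t' - t = t] after cancellation. *)
have t'E : t' = 2%:R * t.
  have e1 : t' * S1 p c = t * A p c by rewrite !divfK ?gt_eqF.
  have : t' * A u c * (t' - 2%:R * t) = 0.
    by move: e1; rewrite S1p Ap => /eqP; rewrite -subr_eq0 => /eqP <-; ring.
  move/eqP; rewrite mulf_eq0 -Ap gt_eqF //= subr_eq0; exact/eqP.
(* This gives the third reduction, at rows [u], [p] of [A2], the parameter [t] again. *)
have A2p' : A2 p c = t * A u c by rewrite A2p S1p Ap t'E; ring.
have pvA2 : pivot A2 u p c.
  split=> // [|a pa|a b bc ua]; last exact/zA2/zlu; first by rewrite A2u.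
  have [qa|aq] := ltnP q a; first exact/zA2/zc.
  by rewrite (ord_eqS qp pa aq).
have := whitney hA2 pvA2; rewrite A2p' A2u mulfK ?gt_eqF //.
set C := _ *m A2 => hC.
have eC : A2 = el p u t *m C by rewrite mulmxA elK // mul1mx.
have zC i j : A2 i j = 0 -> C i j = 0.
  by rewrite {1}eC; apply: el_ge0_eq0 => //; exact: ltW.
exists t, (el p u t *m el q p (2%:R * t) *m el p u t), C; split; last split.
- split=> //; first exact: LowerShort.
    by rewrite -!mulmxA -eC -t'E -eA2.
  have := tau_mul (tau_u (- t)) tA2; rewrite -/C.
  rewrite (_ : _ *m S2 = C) // /C /A2 /S2 /S1 /A1 t'E -(mulrN 2%:R t) !mulmxA.
  by rewrite el3_sym.
- by move=> i j /zA2/zC.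
- by apply: (@nz_lt _ _ _ _ q c) => // [i j /zA2/zC //|]; exact: zC.
Qed.

(** * Nilpotent exponentials and the Chevalley generators *)

Lemma mxexp_nilp3 (K : numFieldType) (n : nat) (N : 'M[K]_n) :
  N *m N *m N = 0 -> mxexp N = 1%:M + N + 2%:R^-1 *: (N *m N).
Proof.
case: n N => [|n] N N3; first by rewrite [LHS]flatmx0 [RHS]flatmx0.
apply: cvg_lim; first exact: norm_hausdorff.
(* The partial sums are constant from the third on, since the cube of [N] vanishes. *)
apply: cvg_near_cst; exists 3 => // m /= m3.
have N0 k : N ^+ k.+3 = 0.
  by rewrite !exprS mulrA mulrA -!mulmxE N3 mul0mx.
rewrite /series /= -(subnKC m3) big_nat_recl // big_nat_recl // big_nat_recl //.
rewrite big1 ?addr0 => [|k _]; last by rewrite N0 scaler0.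
by rewrite expr0 expr1 expr2 fact0 invr1 !scale1r addrA mulmxE.
Qed.

Lemma E_delta (K : pzRingType) (n : nat) (a b : 'I_n) i j :
  i = a.+1 -> j = b.+1 -> E_ K n i j = delta_mx a b.
Proof. by move=> -> ->; apply/matrixP => x y; rewrite !mxE !eqSS. Qed.

Lemma mxexp_nilp2 (K : numFieldType) (n : nat) (N : 'M[K]_n) :
  N *m N = 0 -> mxexp N = 1%:M + N.
Proof. by move=> N2; rewrite mxexp_nilp3 N2 ?mul0mx // scaler0 addr0. Qed.

Lemma mxexp_nilp3_tr (K : numFieldType) (n : nat) (N : 'M[K]_n) :
  N *m N *m N = 0 -> mxexp N^T = (mxexp N)^T.
Proof.
move=> N3; rewrite !mxexp_nilp3 //; last by rewrite -!trmx_mul mulmxA N3 trmx0.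
by rewrite !linearD /= linearZ /= trmx1 trmx_mul.
Qed.

(** Transposition exchanges the exponentials of the two kinds of generators, so one computation
    serves index [-i] for [X] and index [i] for [X^T]. *)
Lemma chev_gensP (C : numClosedFieldType) (n i : nat) (s : C) (X : 'M[C]_n) :
  (0 < i <= n./2)%N -> 0 < s ->
  let N := s *: (chevE C n i)^T in
  N *m N *m N = 0 -> X = mxexp N -> chev_gens X /\ chev_gens X^T.
Proof.
move=> /andP[i0 ik] s0 N N3 ->; split.
  exists (- i%:Z), s; split=> //; first by rewrite abszN /= i0.
  by rewrite /chevX oppr_gt0 ltNge /= abszN.
exists i%:Z, s; split=> //; first by rewrite /= i0.
by rewrite /chevX ltz_nat i0 -mxexp_nilp3_tr // linearZ /= trmxK.
Qed.

Lemma chevE_lt (C : numClosedFieldType) (n i : nat) : (i < n./2)%N ->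
  chevE C n i = E_ C n i i.+1 + E_ C n (n - i) (n - i).+1.
Proof.
move=> ik; rewrite /chevE ik; have := odd_double_half n.
case: (odd n) => /= en.
  by rewrite (_ : (n - i)%N = (n./2.*2 - i).+1) //; lia.
by rewrite (_ : (n - i)%N = (n./2.*2 - i)%N) //; lia.
Qed.

(** In the first half of the rows, the generator of index [p.+1] is a sum of two matrix units all of
    whose products vanish, so its exponential is [1 + N] and factors into two elementary
    matrices. *)
Lemma chev_pair (C : numClosedFieldType) (n : nat) (p q : 'I_n) (t : C) :
  0 < t -> q = p.+1 :> nat -> (q < rev_ord q)%N ->
  chev_gens (el (rev_ord p) (rev_ord q) t *m el q p t) /\
  chev_gens (el (rev_ord p) (rev_ord q) t *m el q p t)^T.
Proof.
move=> t0 qp lt; set q' := rev_ord p; set p' := rev_ord q.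
have hp : (p.+1 < n./2)%N by move: lt (ltn_ord p) => /=; lia.
have nqp := neq_succ qp; have nqp' := neq_succ (el_rev_lt qp).
have pq' : p != q' by rewrite -val_eqE /=; move: lt => /=; lia.
have p'q : p' != q by rewrite -val_eqE /=; move: lt => /=; lia.
have eF : (chevE C n p.+1)^T = delta_mx q p + delta_mx q' p'.
  rewrite chevE_lt // (@E_delta _ _ p q) // -?qp // (@E_delta _ _ p' q').
  - by rewrite linearD /= !trmx_delta.
  - by move: lt => /=; lia.
  - by move: lt => /=; lia.
have F2 : (chevE C n p.+1)^T *m (chevE C n p.+1)^T = 0.
  rewrite eF mulmxDl !mulmxDr !mul_delta_mx_cond eq_sym (negbTE nqp).
  by rewrite (negbTE pq') (negbTE p'q) eq_sym (negbTE nqp') !mulr0n !addr0.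
have N2 : t *: (chevE C n p.+1)^T *m (t *: (chevE C n p.+1)^T) = 0.
  by rewrite -scalemxAl -scalemxAr F2 !scaler0.
apply: (chev_gensP (i := p.+1) _ t0); first by lia.
  by rewrite N2 mul0mx.
rewrite mxexp_nilp2 // eF /el mulmxDl !mulmxDr !mul1mx !mulmx1.
rewrite -!scalemxAl -!scalemxAr mul_delta_mx_cond (negbTE p'q) mulr0n !scaler0.
by rewrite addr0 scalerDr addrA.
Qed.

Lemma chev_long (C : numClosedFieldType) (n : nat) (p q : 'I_n) (t : C) :
  0 < t -> q = p.+1 :> nat -> rev_ord q = p ->
  chev_gens (el q p t) /\ chev_gens (el q p t)^T.
Proof.
move=> t0 qp /(congr1 (@nat_of_ord n)) /= e.
have nE : n = p.+1.*2 by move: (ltn_ord q); lia.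
have kE : n./2 = p.+1 by rewrite [in LHS]nE doubleK.
have nqp := neq_succ qp.
have eF : (chevE C n p.+1)^T = delta_mx q p.
  rewrite /chevE kE ltnn (_ : odd n = false); last by rewrite [in LHS]nE odd_double.
  by rewrite (@E_delta _ _ p q) ?trmx_delta // qp.
have N2 : t *: (chevE C n p.+1)^T *m (t *: (chevE C n p.+1)^T) = 0.
  rewrite eF -scalemxAl -scalemxAr mul_delta_mx_cond eq_sym (negbTE nqp).
  by rewrite mulr0n !scaler0.
apply: (chev_gensP (i := p.+1) _ t0); first by rewrite kE leqnn.
  by rewrite N2 mul0mx.
by rewrite mxexp_nilp2 // eF.
Qed.

Lemma chev_short (C : numClosedFieldType) (n : nat) (u p q : 'I_n) (t : C) :
  0 < t -> p = u.+1 :> nat -> q = p.+1 :> nat -> rev_ord p = p ->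
  let X := el p u t *m el q p (2%:R * t) *m el p u t in
  chev_gens X /\ chev_gens X^T.
Proof.
move=> t0 pu qp /(congr1 (@nat_of_ord n)) /= e.
have nE : n = (true + u.+1.*2)%N by move: (ltn_ord q); lia.
have kE : n./2 = u.+1 by rewrite [in LHS]nE half_bit_double.
have nqp := neq_succ qp; have npu := neq_succ pu.
have nqu : q != u.
  by apply/eqP => E; have : (u < q)%N by [rewrite qp pu ltnW]; rewrite E ltnn.
have s2 : sqrtC (2%:R : C) ^+ 2 = 2%:R by exact: sqrtCK.
have s20 : 0 < sqrtC (2%:R : C) by rewrite sqrtC_gt0 ltr0n.
have eF : (chevE C n u.+1)^T = sqrtC 2%:R *: (delta_mx p u + delta_mx q p).
  rewrite /chevE kE ltnn (_ : odd n); last by rewrite nE /= odd_double.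
  rewrite (@E_delta _ _ u p) // -?pu // (@E_delta _ _ p q) // -?qp //.
  by rewrite linearZ /= linearD /= !trmx_delta.
(* This parameter and the factor [sqrtC 2%:R] in the generator multiply to the [2%:R * t] of
   [el3]. *)
set s := sqrtC 2%:R * t.
have s0 : 0 < s by rewrite mulr_gt0.
have sF : s *: (chevE C n u.+1)^T = (2%:R * t) *: (delta_mx p u + delta_mx q p).
  by rewrite eF scalerA /s mulrAC -expr2 s2.
have D2 : (delta_mx p u + delta_mx q p) *m (delta_mx p u + delta_mx q p)
    = delta_mx q u :> 'M[C]_n.
  rewrite mulmxDl !mulmxDr !mul_delta_mx_cond eqxx (eq_sym u p) (negbTE npu).
  by rewrite (eq_sym u q) (negbTE nqu) (eq_sym p q) (negbTE nqp) !mulr0n !add0r addr0.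
have N2 : s *: (chevE C n u.+1)^T *m (s *: (chevE C n u.+1)^T) =
    ((2%:R * t) * (2%:R * t)) *: delta_mx q u.
  by rewrite sF -scalemxAl -scalemxAr D2 scalerA.
have N3 : s *: (chevE C n u.+1)^T *m (s *: (chevE C n u.+1)^T)
    *m (s *: (chevE C n u.+1)^T) = 0.
  rewrite N2 sF -scalemxAl -scalemxAr mulmxDr !mul_delta_mx_cond (eq_sym u p).
  by rewrite (negbTE npu) (eq_sym u q) (negbTE nqu) !mulr0n addr0 !scaler0.
apply: (chev_gensP (i := u.+1) _ s0 N3); first by rewrite kE leqnn.
rewrite mxexp_nilp3 // N2 sF scalerA el3 //; congr (_ + _ *: _).
by field.
Qed.

Lemma lower_gen_chev (C : numClosedFieldType) (n : nat) (t : C) (X : 'M[C]_n) :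
  0 < t -> lower_gen t X -> chev_gens X /\ chev_gens X^T.
Proof.
move=> + h; case: h => [p q {}t qp qp' qq pp|p q {}t qp qp'|u p q {}t pu qp pp] t0.
- have [lt|gt|/ord_inj e] := ltngtP q (rev_ord q); last by rewrite -e eqxx in qq.
    exact: chev_pair.
  (* A pair in the second half of the rows is the reflection of one in the first half, with the two
     commuting factors interchanged. *)
  set X' := _ *m _.
  have -> : X' = el (rev_ord (rev_ord q)) (rev_ord (rev_ord p)) t
      *m el (rev_ord p) (rev_ord q) t.
    rewrite /X' !rev_ordK el_comm //; last by rewrite eq_sym.
  apply: chev_pair => //; first exact: el_rev_lt.
  rewrite rev_ordK; move: gt qp' pp (ltn_ord q); rewrite -!val_eqE /=; lia.
- exact: chev_long.
- exact: chev_short.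
Qed.

(** * Laurent polynomial functions and positivity of torus characters *)

Definition laurent (K : fieldType) (f : K -> K) : Prop :=
  exists (P : {poly K}) (N : nat), forall x, x != 0 -> f x * x ^+ N = P.[x].

Lemma laurent_cst (K : fieldType) (c : K) : laurent (fun _ => c).
Proof. by exists c%:P, 0%N => x _; rewrite hornerC mulr1. Qed.

Lemma laurentD (K : fieldType) (f g : K -> K) :
  laurent f -> laurent g -> laurent (fun x => f x + g x).
Proof.
move=> [P [N hf]] [Q [M hg]]; exists (P * 'X^M + Q * 'X^N), (N + M)%N => x x0.
by rewrite hornerD !hornerM !hornerXn -hf // -hg // exprD; ring.
Qed.

Lemma laurentM (K : fieldType) (f g : K -> K) :
  laurent f -> laurent g -> laurent (fun x => f x * g x).
Proof.
move=> [P [N hf]] [Q [M hg]]; exists (P * Q), (N + M)%N => x x0.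
by rewrite hornerM -hf // -hg // exprD; ring.
Qed.

Lemma laurent_exp (K : fieldType) (f : K -> K) m :
  laurent f -> laurent (fun x => f x ^+ m).
Proof.
move=> hf; elim: m => [|m IH]; first exact: laurent_cst.
by under [X in laurent X]funext do rewrite exprS; exact: laurentM.
Qed.

Lemma laurent_sum (K : fieldType) (I : Type) (r : seq I) (F : I -> K -> K) :
  (forall i, laurent (F i)) -> laurent (fun x => \sum_(i <- r) F i x).
Proof.
move=> hF; elim: r => [|i r IH].
  by under [X in laurent X]funext do rewrite big_nil; exact: laurent_cst.
by under [X in laurent X]funext do rewrite big_cons; exact: laurentD.
Qed.

Lemma laurent_prod (K : fieldType) (I : Type) (r : seq I) (F : I -> K -> K) :
  (forall i, laurent (F i)) -> laurent (fun x => \prod_(i <- r) F i x).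
Proof.
move=> hF; elim: r => [|i r IH].
  by under [X in laurent X]funext do rewrite big_nil; exact: laurent_cst.
by under [X in laurent X]funext do rewrite big_cons; exact: laurentM.
Qed.

Lemma laurent_meval (K : fieldType) n (v : K -> 'I_n -> K) (p : mpoly.mpoly n K) :
  (forall j, laurent (v^~ j)) -> laurent (fun x => mpoly.meval (v x) p).
Proof.
move=> hv; under [X in laurent X]funext do rewrite mpoly.mevalE.
apply: laurent_sum => m; apply: laurentM; first exact: laurent_cst.
by apply: laurent_prod => i; exact: laurent_exp.
Qed.

(* A polynomial without nonzero root is a monomial, so f is x |-> x ^ m for
   some integer m. *)
Lemma laurent_character_gt0 (C : numClosedFieldType) (f : C -> C) :
  laurent f -> (forall x, x != 0 -> f x != 0) ->
  (forall x y, x != 0 -> y != 0 -> f (x * y) = f x * f y) ->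
  forall x, 0 < x -> 0 < f x.
Proof.
move=> [P [N hP]] f0 fM x x0.
have n1 : (1 : C) != 0 := oner_neq0 C.
have P0 : P != 0.
  by apply/eqP => E; have := hP 1 n1; rewrite E horner0 expr1n mulr1 => /eqP;
    rewrite (negbTE (f0 _ n1)).
have [m [q]] := multiplicity_XsubC P 0; rewrite P0 subr0 /= => q0 PE.
have /size_poly1P[c c0 qE] : size q == 1%N.
  apply: contraNT q0 => /closed_rootP[y ry]; have [<- //|y0] := eqVneq y 0.
  have := hP y y0; rewrite PE hornerM (rootP ry) mul0r => /eqP.
  by rewrite mulf_eq0 expf_eq0 (negbTE y0) andbF orbF (negbTE (f0 _ y0)).
have fE y : y != 0 -> f y = c * y ^+ m / y ^+ N.
  move=> y0; apply: (canRL (mulfK _)); first by rewrite expf_neq0.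
  by rewrite hP // PE qE hornerM hornerC hornerXn.
have f1 : f 1 = 1.
  apply: (mulfI (f0 _ n1)); rewrite mulr1 -fM // mulr1 //.
have c1 : c = 1 by rewrite -f1 fE // !expr1n divr1 mulr1.
by rewrite fE ?gt_eqF // c1 mul1r divr_gt0 ?exprn_gt0.
Qed.

Lemma tau_diag_mx (K : fieldType) (n : nat) (d : 'rV[K]_n) :
  (forall i, d 0 i * d 0 (rev_ord i) = 1) -> tau (diag_mx d) (diag_mx d).
Proof.
move=> hd; rewrite /tau tr_diag_mx; apply/matrixP => i j.
rewrite mul_mx_diag mxE mul_diag_mx mxE OmegaE; case: eqP => [->|_].
  by rewrite mulrAC hd mul1r.
by rewrite mulr0n mulr0 mul0r.
Qed.

Lemma TOmega_diag_mx (K : fieldType) (n : nat) (d : 'rV[K]_n) :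
  (forall i, d 0 i * d 0 (rev_ord i) = 1) -> @TOmega K n (diag_mx d).
Proof.
move=> hd; have td := tau_diag_mx hd; split; last exact: diag_mx_is_diag.
by split=> //; exact: tau_unit td.
Qed.

(** For [i] off the middle, the value at [x] of a standard cocharacter of the torus. *)
Definition coweight (K : fieldType) (n : nat) (i : 'I_n) (x : K) : 'rV[K]_n :=
  \row_j if j == i then x else if j == rev_ord i then x^-1 else 1.

Lemma coweight_rev (K : fieldType) (n : nat) (i : 'I_n) (x : K) :
  i != rev_ord i -> x != 0 ->
  forall j, coweight i x 0 j * coweight i x 0 (rev_ord j) = 1.
Proof.
move=> ir x0 j; rewrite !mxE (inj_eq rev_ord_inj) (can2_eq rev_ordK rev_ordK).
case: (altP (j =P i)) => [->|_]; first by rewrite (negbTE ir) mulfV.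
by case: eqP => _; rewrite ?mulVf ?mulr1.
Qed.

(** A regular function restricted to a cocharacter is a Laurent polynomial: the entries and the
    inverse of the determinant both are. Hence [laurent_character_gt0] applies. *)
Lemma character_coweight_gt0 (C : numClosedFieldType) (n : nat) (i : 'I_n)
    (chi : 'M[C]_n -> C) (x : C) :
  character (@TOmega C n) chi -> i != rev_ord i -> 0 < x ->
  0 < chi (diag_mx (coweight i x)).
Proof.
move=> [[p [m hchi]] chi0 chiM] ir; move: x.
have hT x : x != 0 -> @TOmega C n (diag_mx (coweight i x)).
  by move=> x0; apply/TOmega_diag_mx/coweight_rev.
have lc j : laurent (fun x => coweight i x 0 j).
  under [X in laurent X]funext do rewrite mxE.
  case: eqP => _; first by exists 'X, 0%N => x _; rewrite hornerX mulr1.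
  case: eqP => _; last exact: laurent_cst.
  by exists 1, 1%N => x x0; rewrite mulVf // hornerC.
have lcV j : laurent (fun x => (coweight i x 0 j)^-1).
  under [X in laurent X]funext do rewrite mxE.
  case: eqP => _; first by exists 1, 1%N => x x0; rewrite mulVf // hornerC.
  case: eqP => _; last exact: laurent_cst.
  by exists 'X, 0%N => x _; rewrite hornerX invrK mulr1.
apply: laurent_character_gt0 => [|x x0|x y x0 y0]; last 1 first.
- rewrite -chiM; [|exact: hT|exact: hT]; congr chi; rewrite mulmx_diag; congr diag_mx.
  apply/rowP => j; rewrite !mxE; case: eqP => // _.
  case: eqP => _; last by rewrite mulr1.
  by rewrite invfM.
- have [P [N hP]] : laurent (fun x => mpoly.meval
      (fun j => mxvec (diag_mx (coweight i x)) 0 j) p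
      / \det (diag_mx (coweight i x)) ^+ m).
    apply: laurentM.
      apply: laurent_meval => j; case/mxvec_indexP: j => a b.
      under [X in laurent X]funext do rewrite mxvecE mxE.
      by case: eqP => _; [exact: lc|exact: laurent_cst].
    under [X in laurent X]funext do rewrite -exprVn det_diag -prodfV.
    by apply: laurent_exp; apply: laurent_prod.
  by exists P, N => x x0; rewrite hchi ?hP //; exact: hT.
- by apply: chi0; exact: hT.
Qed.

(** A positive diagonal element is a product of cocharacter values at positive arguments, removed
    one at a time. *)
Lemma character_diag_gt0 (C : numClosedFieldType) (n : nat)
    (chi : 'M[C]_n -> C) (d : 'rV[C]_n) :
  character (@TOmega C n) chi ->
  (forall i, d 0 i * d 0 (rev_ord i) = 1) -> (forall i, 0 < d 0 i) ->
  0 < chi (diag_mx d).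
Proof.
move=> hchi; have [_ chi0 chiM] := hchi.
(* From index [m] on, the entries in the first half are already 1; at [m = n] the condition is
   void. *)
have [m] : exists m, forall i : 'I_n, (m <= i)%N -> (i < rev_ord i)%N -> d 0 i = 1.
  by exists n => i; rewrite leqNgt ltn_ord.
elim: m d => [|m IH] d d1 dr d0.
  have di i : d 0 i = 1.
    have [lt|gt|/ord_inj e] := ltngtP i (rev_ord i); first exact: d1.
      by rewrite -(dr (rev_ord i)) rev_ordK (d1 (rev_ord i)) ?mul1r ?rev_ordK.
    (* The middle entry has square 1, and positivity excludes -1. *)
    by apply/eqP; rewrite -(sqrp_eq1 (ltW (d0 i))) expr2 {2}e dr.
  have -> : diag_mx d = 1%:M.
    by rewrite -diag_const_mx; congr diag_mx; apply/rowP => i; rewrite mxE di.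
  have T1 : @TOmega C n 1%:M.
    rewrite -diag_const_mx; apply: TOmega_diag_mx => i.
    by rewrite !mxE mulr1.
  suff -> : chi 1%:M = 1 by exact: ltr01.
  by apply: (mulfI (chi0 _ T1)); rewrite mulr1 -chiM // mul1mx.
have [[i [im ir]]|no] :=
  pselect (exists i : 'I_n, i = m :> nat /\ (i < rev_ord i)%N); last first.
  apply: IH => // i; rewrite leq_eqVlt => /orP[/eqP e lt|]; last exact: d1.
  by case: no; exists i.
have nir : i != rev_ord i by rewrite -val_eqE /= ltn_eqF.
pose d' : 'rV_n := \row_j if (j == i) || (j == rev_ord i) then 1 else d 0 j.
have d'r j : d' 0 j * d' 0 (rev_ord j) = 1.
  rewrite !mxE (inj_eq rev_ord_inj) (can2_eq rev_ordK rev_ordK) orbC.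
  by case: ifP => _; rewrite ?mulr1.
have d'0 j : 0 < d' 0 j by rewrite mxE; case: ifP.
have -> : diag_mx d = diag_mx (coweight i (d 0 i)) *m diag_mx d'.
  rewrite mulmx_diag; congr diag_mx; apply/rowP => j; rewrite !mxE.
  case: eqP => [->|_]; first by rewrite mulr1.
  case: eqP => [->|_] /=; last by rewrite mul1r.
  rewrite mulr1 -[LHS]mul1r -(mulVf (x := d 0 i)) ?gt_eqF //.
  by rewrite -mulrA dr mulr1.
rewrite chiM; first last.
- exact: TOmega_diag_mx.
- by apply/TOmega_diag_mx/coweight_rev; rewrite // gt_eqF.
rewrite mulr_gt0 //; first exact: character_coweight_gt0.
apply: IH => // j mj jr; rewrite mxE; case: ifPn => //; rewrite negb_or => /andP[ji _].
by apply: d1 => //; rewrite ltn_neqAle mj andbT -im eq_sym.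
Qed.

(** * Factorization of tau-fixed totally nonnegative matrices *)

Lemma lower_factor (K : numFieldType) (n : nat) (S : 'M[K]_n -> Prop) :
  S 1%:M -> (forall A B, S A -> S B -> S (A *m B)) ->
  (forall t X, 0 < t -> lower_gen t X -> S X) ->
  forall A, totally_nonneg A -> tau A A ->
  exists L U, [/\ S L, A = L *m U, totally_nonneg U, tau U U & upper U]
    /\ forall i j, A i j = 0 -> U i j = 0.
Proof.
move=> S1 SM Sg A; have [m] := ubnP (nz A); elim: m A => // m IH A Am hA tA.
have [up|nup] := pselect (upper A).
  by exists 1%:M, A; split=> //; split=> //; rewrite mul1mx.
have [t [X [B [[t0 gX AE hB tB] [zB nzB]]]]] := lower_step hA tA nup.
have [||//|L [U [[SL BE hU tU upU] zU]]] := IH B.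
- by rewrite (leq_trans nzB).
- by [].
exists (X *m L), U; split; last by move=> i j /zB/zU.
by split=> //; [apply: SM => //; exact: Sg gX|rewrite -mulmxA -BE].
Qed.

Theorem proposition6p1 (R : realType) (n : nat) (A : 'M[complex R]_n) :
  GOmega A -> totally_nonneg A -> GOmega_ge0 A.
Proof.
(* [M] is an arbitrary submonoid containing the generators, as in the definition of [smallest]. *)
move=> [_ tA] hA M /= [[M1 MM] gM].
have Mg t X : 0 < t -> lower_gen t X -> M X /\ M X^T.
  by move=> t0 /(lower_gen_chev t0)[gX gXt]; split; apply: gM; right.
have [|L [U [[ML -> hU tU upU] _]]] := lower_factor M1 MM _ hA tA.
  by move=> t X t0 /(Mg _ _ t0)[].
apply: (MM _ _ ML).
(* The second factorization, of [U^T], uses the predicate [M X^T], so that transposing back puts the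
   factor into [M]. *)
have [|||L' [D [[ML' UE hD tD upD] zD]]] :=
  @lower_factor _ _ (fun X => M X^T) _ _ _ U^T (tnn_tr hU) (tau_tr tU).
- by rewrite trmx1.
- by move=> X Y MX MY; rewrite trmx_mul; exact: MM.
- by move=> t X t0 /(Mg _ _ t0)[].
(* [D] is upper triangular and inherits the zeros of the lower triangular [U^T]. *)
have dD : is_diag_mx D.
  apply/is_diag_mxP => i j; rewrite neq_ltn => /orP[ij|/upD //].
  by apply: zD; rewrite mxE upU.
have DE : D = diag_mx (\row_i D i i).
  apply/matrixP => i j; rewrite !mxE; case: eqP => [->//|/eqP ij].
  by move/is_diag_mxP: dD => -> //.
have Drev i : D i i * D (rev_ord i) (rev_ord i) = 1.
  by rewrite (tau_diag dD tD i (rev_ord i)) eqxx.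
rewrite -[U]trmxK UE trmx_mul; apply: MM ML'; apply: gM; left.
rewrite DE tr_diag_mx; split; first by apply: TOmega_diag_mx => i; rewrite !mxE.
move=> chi hchi; apply: character_diag_gt0 => // i; rewrite !mxE //.
rewrite lt0r tnn_ge0 // andbT; apply/eqP => D0.
by have := Drev i; rewrite D0 mul0r => /esym/eqP; rewrite oner_eq0.
Qed.
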